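(* Let $\overline V$ be an $n$-dimensional Minkowski space, let $\overline{\overline e}$ be an orthonormal basis of $\overline V$, and let the coordinates $g_{ij}$ of the metric tensor and all vector coordinates be taken relative to $\overline{\overline e}$. Let the infinitesimal motion $$a'^i=a^j(\delta^i_j+A^i_j\,dt)$$ map the orthonormal basis $\overline{\overline e}$ to the orthonormal basis $\overline{\overline e}'$, $e'^i_k=e^j_k(\delta^i_j+A^i_j\,dt)$. Then for all $k\le l$ $$g_{kp}(\overline e_k)A^p_l+g_{pl}(\overline e_k)A^p_k=0$$ (summation over $p$, no summation over $k,l$).
   Context: A Minkowski space is a finite-dimensional real vector space $\overline V$ with a Finsler structure $F$ such that: (1) the Finsler metric $F^2:\overline V\to\mathbb R$ is real valued, not necessarily positive definite, and smooth at nonzero vectors; (2) $F(a\overline x)=aF(\overline x)$ for $a>0$; (3) relative to a basis, the coordinates of the metric tensor $g_{ij}(\overline v)=\frac12\frac{\partial^2F^2(\overline v)}{\partial v^i\partial v^j}$, $\overline v\ne 0$, form a nonsingular symmetric matrix. Summation over repeated coordinate indices is understood. A basis $\overline{\overline e}$ is orthonormal if $g_{ij}(\overline e_k)e_k^ie_l^j=0$ for all $k<l$ and $|F(\overline e_k)|=1$, i.e. $g_{ij}(\overline e_k)e_k^ie_k^j=\pm1$. Infinitesimal statements are understood to first order: the matrix $A=(A^i_j)$ defines an infinitesimal motion mapping the orthonormal basis $\overline{\overline e}$ to an orthonormal basis if the vectors with coordinates $e'^i_k(t)=e_k^j(\delta^i_j+tA^i_j)$ satisfy, as $t\to0$, $g_{ij}(\overline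 e'_k(t))e'^i_k(t)e'^j_l(t)=g_{ij}(\overline e_k)e^i_ke^j_l+o(t)$ for all $k\le l$. Relative to $\overline{\overline e}$ itself one has $e^i_k=\delta^i_k$. *)

(* Defs.v *)
From mathcomp Require Import all_boot all_order all_algebra.
From mathcomp Require Import complex.
From mathcomp Require Import all_classical all_reals all_analysis.

Set Implicit Arguments.
Unset Strict Implicit.
Unset Printing Implicit Defensive.

Import Order.TTheory GRing.Theory Num.Theory.
Import numFieldNormedType.Exports.

Local Open Scope classical_set_scope.
Local Open Scope complex_scope.
Local Open Scope ring_scope.

Section Smooth.
Context {R : realType} {m : nat}.
Implicit Types (D : set 'rV[R]_m) (f : 'rV[R]_m -> R).

Definition partial (i : 'I_m) f : 'rV[R]_m -> R := 'D_(delta_mx 0 i) f.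

(* [D] is meant to be open. *)
Fixpoint Ck (k : nat) D f : Prop :=
  (forall x, D x -> {for x, continuous f}) /\
  (if k is k'.+1 then
     forall i : 'I_m,
       (forall x, D x -> derivable f x (delta_mx 0 i)) /\ Ck k' D (partial i f)
   else True).

Definition smooth D f : Prop := forall k, Ck k D f.

End Smooth.

Section Minkowski.
Context {R : realType} {V : vectType R}.

Definition coords {m} (b : m.-tuple V) (v : V) : 'rV[R]_m :=
  \row_i coord b i v.

Definition of_coords {m} (b : m.-tuple V) (x : 'rV[R]_m) : V :=
  \sum_(i < m) x 0 i *: tnth b i.

(* [F] is complex valued because its square may take negative values. *)
Definition finsler_metric (F : V -> R[i]) (v : V) : R := complex.Re (F v ^+ 2).

(* The matrix [g_ij] relative to the basis [b], at the vector whose coordinates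
   in [b] are [x]. *)
Definition metric_tensor (F : V -> R[i]) {m} (b : m.-tuple V) (x : 'rV[R]_m) :
    'M[R]_m :=
  \matrix_(i, j)
    (2^-1 * partial i (partial j (finsler_metric F \o of_coords b)) x).

(* A coordinate condition is required in every basis of [V]; by the chain rule
   it is equivalent to the same condition in a single basis. *)
Record minkowski_space (F : V -> R[i]) : Prop := Minkowski {
  minkowski_real : forall v, F v ^+ 2 \is Num.real;
  minkowski_smooth : forall m (b : m.-tuple V), basis_of fullv b ->
    smooth [set x : 'rV[R]_m | x != 0] (finsler_metric F \o of_coords b);
  minkowski_homogeneous : forall (a : R) v, 0 < a -> F (a *: v) = a%:C * F v;
  minkowski_symmetric : forall m (b : m.-tuple V) (x : 'rV[R]_m),
    basis_of fullv b -> x != 0 -> (metric_tensor F b x)^T = metric_tensor F b x;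
  minkowski_nonsingular : forall m (b : m.-tuple V) (x : 'rV[R]_m),
    basis_of fullv b -> x != 0 -> metric_tensor F b x \in unitmx
}.

(* [g_ij(x) y^i z^j]; all coordinates are relative to [b]. *)
Definition metric_form (F : V -> R[i]) {m} (b : m.-tuple V)
    (x y z : 'rV[R]_m) : R :=
  \sum_i \sum_j metric_tensor F b x i j * y 0 i * z 0 j.

(* The metric form is taken at the vector of smaller index: orthogonality is
   not a symmetric relation here. *)
Definition orthonormal_basis (F : V -> R[i]) {n} (b e : n.-tuple V) : Prop :=
  [/\ basis_of fullv e,
      forall k l : 'I_n, (k < l)%N ->
        metric_form F b (coords b (tnth e k)) (coords b (tnth e k))
          (coords b (tnth e l)) = 0
    & forall k : 'I_n, `|F (tnth e k)| = 1].

(* Coordinates in [b] of the image of [v] under the motion at time [t]; the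
   entry [A i j] is [A^i_j], with upper index [i]. *)
Definition motion {n} (A : 'M[R]_n) (b : n.-tuple V) (v : V) (t : R) :
    'rV[R]_n :=
  \row_i \sum_j coords b v 0 j * ((i == j)%:R + t * A i j).

(* To first order, the motion maps the orthonormal basis [e] to an orthonormal
   basis. *)
Definition infinitesimal_motion (F : V -> R[i]) {n} (b e : n.-tuple V)
    (A : 'M[R]_n) : Prop :=
  forall k l : 'I_n, (k <= l)%N ->
    (fun t : R => metric_form F b (motion A b (tnth e k) t)
       (motion A b (tnth e k) t) (motion A b (tnth e l) t)) =
    (fun _ : R => metric_form F b (coords b (tnth e k))
       (coords b (tnth e k)) (coords b (tnth e l)))
    +o_ (0 : R) (fun t : R => t).

End Minkowski.

(* Main.v *)
(** Write f = F^2 in the coordinates of the basis.  The partial derivatives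
    of f are positively homogeneous of degree 1, so Euler's identity gives
    g_ij(x) x^i = (1/2) d_j f(x): the form g_ij(x) x^i z^j = (1/2) d_j f(x) z^j
    involves only first derivatives of f.  Its derivative at t = 0 along
    (x + t v, z + t w) is therefore g_ij(x) v^i z^j + g_ij(x) x^i w^j, without
    any third derivative of f.  For x = e_k, z = e_l and v, w the columns k, l
    of A this is the left-hand side of the claim, and it vanishes because the
    form is constant up to o(t). *)
Require Import Defs.
From mathcomp Require Import all_boot all_order all_algebra.
From mathcomp Require Import complex.
From mathcomp Require Import all_classical all_reals all_analysis.
From mathcomp Require Import ring.

Import Order.TTheory GRing.Theory Num.Theory.
Import numFieldNormedType.Exports.

Local Open Scope classical_set_scope.
Local Open Scope ring_scope.

(** * Directional derivatives along lines and along sums of directions *)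

Section DirectionalDerivative.
Context {R : realType} {V : normedModType R}.
Implicit Types (f : V -> R) (x y u v : V).

Lemma is_derive_cvgP f x v (d : R) :
  is_derive x v f d <->
  (fun h : R => h^-1 * (f (h *: v + x) - f x)) @ 0^' --> d.
Proof.
split=> [[df <-]|df]; first exact: df.
split; first by apply/cvg_ex; exists d.
exact/cvg_lim.
Qed.

Lemma is_derive_lineP f y v (s d : R) :
  is_derive s 1 (fun r : R => f (y + r *: v)) d <->
  is_derive (y + s *: v) v f d.
Proof.
suff E : (fun h : R => h^-1 * (f (y + (h *: 1 + s) *: v) - f (y + s *: v))) =
         (fun h : R => h^-1 * (f (h *: v + (y + s *: v)) - f (y + s *: v))).
  rewrite is_derive_cvgP -E; split=> [[df <-]|df]; first exact: df.
  split; first by apply/cvg_ex; exists d.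
  exact/cvg_lim.
apply/funext => h; congr (_ * (f _ - _)).
by rewrite [h *: _]mulr1 scalerDl addrCA.
Qed.

(** The sign of [d] is left free because the increment [h * c] in [is_derive_addZ] takes both signs;
    the one-variable theorem is applied on [[0, d]] or on [[d, 0]]. *)
Lemma line_MVT f y v (d : R) :
  (forall s : R, `|s| <= `|d| -> derivable f (y + s *: v) v) ->
  exists2 s, `|s| <= `|d| & f (y + d *: v) - f y = d * 'D_v f (y + s *: v).
Proof.
move=> df; set g := fun r : R => f (y + r *: v).
have dg (s : R) : `|s| <= `|d| -> is_derive s 1 g ('D_v f (y + s *: v)).
  by move=> sd; apply/is_derive_lineP; split; [exact: df|].
have cg (a b : R) : (forall s, a <= s <= b -> `|s| <= `|d|) ->
    {within `[a, b], continuous g}.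
  move=> ab; apply: derivable_within_continuous => s; rewrite in_itv /= => /ab sd.
  by have [] := dg s sd.
have g0 : g 0 = f y by rewrite /g scale0r addr0.
case: (leP 0 d) => d0.
- have dd s : 0 <= s <= d -> `|s| <= `|d|.
    by case/andP=> s0 sd; rewrite !ger0_norm.
  have [s||s /= sd] := @MVT_segment _ g (fun s => 'D_v f (y + s *: v)) 0 d d0.
  + by rewrite in_itv /= => /andP[s0 sd]; apply: dg; apply: dd; rewrite !ltW.
  + exact: cg.
  + by rewrite subr0 g0 mulrC; exists s => //; apply: dd; rewrite in_itv in sd.
- have dd s : d <= s <= 0 -> `|s| <= `|d|.
    by case/andP=> s0 sd; rewrite !ler0_norm ?lerN2// ltW.
  have [s||s /= sd] := @MVT_segment _ g (fun s => 'D_v f (y + s *: v)) d 0 (ltW d0).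
  + by rewrite in_itv /= => /andP[s0 sd]; apply: dg; apply: dd; rewrite !ltW.
  + exact: cg.
  + rewrite sub0r g0 => E; exists s; first by apply: dd; rewrite in_itv in sd.
    by rewrite -[LHS]opprB E mulrN opprK mulrC.
Qed.

(** The move from [x] to [x + h (u + c v)] is split into [h u] followed by [h c v]. By the mean
    value theorem the second increment is [h c] times ['D_v f] at an intermediate point, which tends
    to [x], where ['D_v f] is continuous. *)
Lemma is_derive_addZ f x u v (c d : R) :
  (\forall y \near x, derivable f y v) -> {for x, continuous ('D_v f)} ->
  is_derive x u f d -> is_derive x (u + c *: v) f (d + c * 'D_v f x).
Proof.
move=> df cf /is_derive_cvgP fu; apply/is_derive_cvgP.
rewrite (_ : (fun h : R => _) =
  (fun h : R => h^-1 * (f (h *: u + x) - f x)) +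
  (fun h : R => h^-1 * (f (h *: (u + c *: v) + x) - f (h *: u + x)))); last first.
  by apply/funext => h; rewrite !fctE -mulrDr [X in _ = _ * X]addrC addrA subrK.
apply: cvgD => //; apply/cvgrPdist_le => e e0.
(* The added 1 keeps the divisor positive even for [c = 0]; likewise in [M0] below. *)
have c1 : 0 < `|c| + 1 by rewrite ltr_wpDl.
have /nbhs_ballP[r /= r0 rB] : \forall y \near x,
    derivable f y v /\ `|'D_v f x - 'D_v f y| <= e / (`|c| + 1).
  near=> y; split; first by near: y.
  by near: y; move/cvgrPdist_le : cf; apply; rewrite divr_gt0.
have rP y : `|x - y| < r ->
    derivable f y v /\ `|'D_v f x - 'D_v f y| <= e / (`|c| + 1).
  by move=> xy; apply: rB; rewrite -ball_normE.
have M0 : 0 < `|u| + `|c| * `|v| + 1 by rewrite ltr_wpDl ?addr_ge0 ?mulr_ge0.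
near=> h.
have h0 : h != 0 by near: h; exact: nbhs_dnbhs_neq.
have hr : `|h| < r / (`|u| + `|c| * `|v| + 1).
  by near: h; apply: dnbhs0_lt; rewrite divr_gt0.
(* The whole second segment stays within [|h| (|u| + |c| |v|)] of [x], hence in the ball of radius
   [r]. *)
have near_x s : `|s| <= `|h * c| -> `|x - ((h *: u + x) + s *: v)| < r.
  move=> sh; rewrite -addrA opprD addrCA opprD addNKr -opprD normrN.
  apply: (le_lt_trans (ler_normD _ _)); rewrite !normrZ.
  apply: (@le_lt_trans _ _ (`|h| * (`|u| + `|c| * `|v| + 1))).
    rewrite !mulrDr -addrA lerD2l mulr1 mulrA -normrM ler_wpDr//.
    by rewrite ler_wpM2r.
  by rewrite -ltr_pdivlMr.
have [s sh E] := @line_MVT f (h *: u + x) v (h * c)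
  (fun s sh => (rP _ (near_x s sh)).1).
rewrite (_ : h *: (u + c *: v) + x = h *: u + x + (h * c) *: v); last first.
  by rewrite scalerDr scalerA addrAC.
rewrite E mulrA mulKf// -mulrBr normrM.
apply: (@le_trans _ _ (`|c| * (e / (`|c| + 1)))).
  by apply: ler_wpM2l => //; exact: (rP _ (near_x s sh)).2.
by rewrite mulrCA ger_pMr// ler_pdivrMr// mul1r lerDl.
Unshelve. all: by end_near. Qed.

End DirectionalDerivative.

(** * Partial derivatives, homogeneous functions and Euler's identity *)

(** The direction is built up one coordinate at a time with [is_derive_addZ], starting from the zero
    direction. *)
Lemma is_derive_partials {R : realType} {m : nat} (f : 'rV[R]_m -> R)
    (x w : 'rV[R]_m) :
  (forall i, \forall y \near x, derivable f y (delta_mx 0 i)) ->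
  (forall i, {for x, continuous (partial i f)}) ->
  is_derive x w f (\sum_i w 0 i * partial i f x).
Proof.
move=> df cf; rewrite {1}(row_sum_delta w).
apply: (big_rec2 (fun u d => is_derive x u f d)); first exact: is_derive0.
move=> i d u _ fu.
rewrite [X in is_derive _ X]addrC [X in is_derive _ _ _ X]addrC.
exact: is_derive_addZ (df i) (cf i) fu.
Qed.

Lemma is_derive_homogeneous {R : realType} {V : normedModType R} (f : V -> R)
    (p : nat) (a : R) (x v : V) (d : R) : 0 < a ->
  (forall b y, 0 < b -> f (b *: y) = b ^+ p.+1 * f y) ->
  is_derive x v f d -> is_derive (a *: x) v f (a ^+ p * d).
Proof.
move=> a0 fM fx; rewrite -[X in is_derive X]addr0 -(scale0r v).
apply/is_derive_lineP.
(* Homogeneity pulls [a] out of the argument; the chain rule then contributes [a^-1], which lowers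
   the power from [p.+1] to [p]. *)
rewrite (_ : (fun r : R => _) =
    (fun r : R => a ^+ p.+1 * f (x + (a^-1 * r) *: v))); last first.
  apply/funext => r; rewrite -fM// scalerDr scalerA mulrA divff ?mul1r//.
  by rewrite gt_eqF.
have fx' : is_derive (a^-1 * 0) 1 (fun r : R => f (x + r *: v)) d.
  by apply/is_derive_lineP; rewrite mulr0 scale0r addr0.
have g : is_derive (0 : R) 1 (fun r : R => a^-1 * r) a^-1.
  have := @is_deriveZ R R^o R^o id a^-1 0 1 1 (is_derive_id _ _).
  by rewrite [_ *: _]mulr1.
have := @is_deriveZ R R^o R^o _ (a ^+ p.+1) 0 1 _ (is_derive1_comp fx' g).
by rewrite [_ *: _]mulrCA exprSr mulfK ?gt_eqF// [d * _]mulrC.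
Qed.

(** The derivative of [f] at [x] along [x] itself is computed twice: through the partials, and from
    [f (x + r x) = (1 + r) f x]. *)
Lemma euler_homogeneous {R : realType} {m : nat} (f : 'rV[R]_m -> R)
    (x : 'rV[R]_m) :
  (forall i, \forall y \near x, derivable f y (delta_mx 0 i)) ->
  (forall i, {for x, continuous (partial i f)}) ->
  (forall a, 0 < a -> f (a *: x) = a * f x) ->
  \sum_i x 0 i * partial i f x = f x.
Proof.
move=> df cf fM; have dx := is_derive_partials f x x df cf.
have /is_derive_lineP dl : is_derive (x + (0 : R) *: x) x f
    (\sum_i x 0 i * partial i f x) by rewrite scale0r addr0.
have dr : is_derive (0 : R) 1 (fun r : R => f (x + r *: x)) (f x).
  have H : is_derive (0 : R) 1 ((cst (f x) : R -> R) + (f x \*: id)) (0 + f x *: 1).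
    exact: is_deriveD.
  move: H; rewrite add0r [_ *: _]mulr1; apply: near_eq_is_derive.
  near=> r; rewrite -{3}[x]scale1r -scalerDl fM ?fctE.
    by rewrite mulrDl mul1r [r * _]mulrC.
  (* The scaling factor [1 + r] must be positive, which holds for [r] near 0. *)
  rewrite -ltrBlDl sub0r; near: r.
  by apply: lt_nbhsr; rewrite oppr_lt0 ltr01.
by case: dl dr => _ <- [_ <-].
Unshelve. all: by end_near. Qed.

(** The difference quotient at 0 is [o(h) / h], so its limit is 0, and limits in [R] are unique. *)
Lemma is_derive_littleo0 {R : realType} (f : R -> R) (a d : R) :
  f = (fun=> a) +o_ (0 : R) (fun t : R => t) -> is_derive (0 : R) 1 f d ->
  f 0 = a -> d = 0.
Proof.
move=> /eqaddoP fo /is_derive_cvgP fd f0.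
apply: (cvg_unique (@Rhausdorff R) fd) => //.
apply/cvgrPdist_le => e e0; near=> h.
have h0 : h != 0 by near: h; exact: nbhs_dnbhs_neq.
rewrite sub0r normrN normrM normfV ler_pdivrMl ?normr_gt0// mulrC.
rewrite [h *: 1]mulr1 addr0 f0.
near: h; apply: cvg_within; exact: fo.
Unshelve. all: by end_near. Qed.

(** * The metric form through first derivatives of the squared Finsler function *)

Section MetricForm.
Context {R : realType} {V : vectType R} {n : nat}.
Variables (F : V -> complex R) (hF : minkowski_space F).
Variables (e : n.-tuple V) (he : basis_of fullv e).

Let f : 'rV[R]_n -> R := finsler_metric F \o of_coords e.

Let f_homogeneous (a : R) (x : 'rV[R]_n) : 0 < a -> f (a *: x) = a ^+ 2 * f x.
Proof.
move=> a0; rewrite /f /finsler_metric /=.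
have -> : of_coords e (a *: x) = a *: of_coords e x.
  rewrite /of_coords scaler_sumr; apply: eq_bigr => i _.
  by rewrite scalerA mxE.
rewrite (minkowski_homogeneous hF)// exprMn.
(* The factor [a ^+ 2] is real, so it passes through the real part. *)
case: (F _ ^+ 2) => p q; rewrite /= expr2 /=; ring.
Qed.

Let open_neq0 (x : 'rV[R]_n) : x != 0 -> \forall y \near x, y != 0.
Proof. by move=> x0; apply: (@cvgr_neq0 _ _ _ (nbhs x) _ id x). Qed.

Let partial_derivable i j (x : 'rV[R]_n) : x != 0 ->
  \forall y \near x, derivable (partial j f) y (delta_mx 0 i).
Proof.
move=> /open_neq0; apply: filterS => y y0.
have [_ /(_ j)[_ [_ /(_ i)[+ _]]]] := minkowski_smooth hF he 2.
exact.
Qed.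

Let partial2_continuous i j (x : 'rV[R]_n) : x != 0 ->
  {for x, continuous (partial i (partial j f))}.
Proof.
have [_ /(_ j)[_ [_ /(_ i)[_ [+ _]]]]] := minkowski_smooth hF he 2.
exact.
Qed.

Let partial_homogeneous j (x : 'rV[R]_n) : x != 0 ->
  forall a : R, 0 < a -> partial j f (a *: x) = a * partial j f x.
Proof.
(* With [p = 1]: [f] has degree 2, so its partials have degree 1. *)
move=> x0 a a0; apply: derive_val; apply: (@is_derive_homogeneous _ _ _ 1) => //.
apply: derivableP; have [_ /(_ j)[+ _]] := minkowski_smooth hF he 1.
exact.
Qed.

(** The contracted index [i] is that of the outer derivative in [metric_tensor], so this is Euler's
    identity for [partial j f]. *)
Lemma metric_tensor_contract (x : 'rV[R]_n) (j : 'I_n) : x != 0 ->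
  \sum_i metric_tensor F e x i j * x 0 i = 2^-1 * partial j f x.
Proof.
move=> x0; rewrite -[in RHS](euler_homogeneous (partial j f) x); last 3 first.
- by move=> i; exact: partial_derivable.
- by move=> i; exact: partial2_continuous.
- exact: partial_homogeneous.
rewrite mulr_sumr; apply: eq_bigr => i _.
by rewrite mxE mulrAC mulrA.
Qed.

Lemma metric_form_diag (x z : 'rV[R]_n) : x != 0 ->
  metric_form F e x x z = \sum_j 2^-1 * partial j f x * z 0 j.
Proof.
move=> x0; rewrite /metric_form exchange_big; apply: eq_bigr => j _.
by rewrite -metric_tensor_contract// mulr_suml.
Qed.

Lemma is_derive_metric_form (x v z w : 'rV[R]_n) : x != 0 ->
  is_derive (0 : R) 1
    (fun t : R => metric_form F e (x + t *: v) (x + t *: v) (z + t *: w))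
    (metric_form F e x v z + metric_form F e x x w).
Proof.
move=> x0.
(* For small [t] the vector [x + t v] is still nonzero, so [metric_form_diag] applies to it. *)
apply: (@near_eq_is_derive _ _ _ (fun t : R =>
   \sum_j 2^-1 * partial j f (x + t *: v) * (z + t *: w) 0 j)).
  near=> t; rewrite metric_form_diag//; near: t.
  apply: (@cvgr_neq0 _ _ _ _ _ _ x) => //.
  rewrite -[X in _ --> X]addr0 -(scale0r v).
  by apply: cvgD; [exact: cvg_cst|apply: cvgZr_tmp; exact: cvg_id].
have dpart j : is_derive (0 : R) 1 (fun t : R => partial j f (x + t *: v))
    (\sum_i v 0 i * partial i (partial j f) x).
  apply/is_derive_lineP; rewrite scale0r addr0.
  by apply: is_derive_partials => i; [exact: partial_derivable
                                     |exact: partial2_continuous].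
have dcoord j : is_derive (0 : R) 1 (fun t : R => (z + t *: w) 0 j) (w 0 j).
  have H : is_derive (0 : R) 1 ((cst (z 0 j) : R -> R) + (w 0 j \*: id))
      (0 + w 0 j *: 1) by exact: is_deriveD.
  move: H; rewrite add0r [_ *: _]mulr1; congr is_derive.
  by apply/funext => t; rewrite !mxE mulrC.
have dterm j : is_derive (0 : R) 1
    (fun t : R => 2^-1 * partial j f (x + t *: v) * (z + t *: w) 0 j)
    (\sum_i metric_tensor F e x i j * v 0 i * z 0 j +
     2^-1 * partial j f x * w 0 j).
  have := is_deriveM (@is_deriveZ R R^o R^o _ 2^-1 0 1 _ (dpart j)) (dcoord j).
  rewrite !fctE scale0r !addr0 addrC; congr is_derive; congr (_ + _); last first.
    by rewrite /= scale0r addr0.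
  rewrite [LHS]mulrC -mulr_suml; congr (_ * _).
  rewrite [LHS]mulr_sumr; apply: eq_bigr => i _.
  by rewrite [in RHS]mxE mulrA mulrAC.
have := @is_derive_sum R R R n _ 0 1 _ dterm; congr is_derive.
  by apply/funext => t; rewrite fct_sumE.
(* The terms with [w] are [metric_form_diag] read backwards; those with [v] are the double sum in
   the other order. *)
by rewrite big_split /= metric_form_diag// [metric_form _ _ _ v _]exchange_big.
Unshelve. all: by end_near. Qed.

End MetricForm.

(** * The motion in coordinates relative to the moved basis *)

Section Coordinates.
Context {R : realType} {V : vectType R} {n : nat}.
Variables (e : n.-tuple V) (he : basis_of fullv e).

Lemma coords_basis (k : 'I_n) : coords e (tnth e k) = delta_mx 0 k.
Proof.
apply/rowP => i; rewrite !mxE eqxx (tnth_nth 0) coord_free ?(basis_free he)//.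
by rewrite eq_sym.
Qed.

(** The coordinates of the basis vector are Kronecker deltas, so it moves on a line whose velocity
    is column [k] of [A], transposed to a row vector. *)
Lemma motion_basis (A : 'M[R]_n) (k : 'I_n) (t : R) :
  motion A e (tnth e k) t = coords e (tnth e k) + t *: row k A^T.
Proof.
apply/rowP => i; rewrite [LHS]mxE coords_basis (bigD1 k)//= big1 => [|j jk].
  by rewrite !mxE !eqxx mul1r addr0.
by rewrite mxE (negPf jk) andbF mul0r.
Qed.

End Coordinates.

Theorem theorem2p4p7 (R : realType) (n : nat) (V : vectType R)
    (dimV : \dim (fullv : {vspace V}) = n)
    (F : V -> complex R) (hF : minkowski_space F)
    (e : n.-tuple V) (he : orthonormal_basis F e e)
    (A : 'M[R]_n) (hA : infinitesimal_motion F e e A) :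
  forall k l : 'I_n, (k <= l)%N ->
    \sum_(p < n) metric_tensor F e (coords e (tnth e k)) k p * A p l +
    \sum_(p < n) metric_tensor F e (coords e (tnth e k)) p l * A p k = 0.
Proof.
move=> k l kl; have [be _ _] := he.
set x := coords e (tnth e k).
have xE : x = delta_mx 0 k by exact: coords_basis.
have x0 : x != 0.
  by apply/eqP => /rowP/(_ k)/eqP; rewrite xE !mxE !eqxx oner_eq0.
have := hA _ _ kl; under eq_fun do rewrite !motion_basis//.
(* The form along the motion is constant up to [o(t)], so its derivative at 0 vanishes. *)
move=> /is_derive_littleo0 /(_ (is_derive_metric_form _ hF _ be _ _ _ _ x0)).
rewrite !scale0r !addr0 => /(_ erefl) E; rewrite -[RHS]E addrC.
congr (_ + _); rewrite /metric_form.
(* The coordinates of [e_l] reduce the sum over [j] to [j = l]; in the other term those of [e_k]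
   reduce the sum over [i] to [i = k]. *)
- apply: eq_bigr => i _; rewrite coords_basis// (bigD1 l)//= big1 => [|j jl].
    by rewrite addr0 !mxE !eqxx mulr1.
  by rewrite !mxE (negPf jl) andbF mulr0.
- rewrite [RHS](bigD1 k)//= [X in _ + X]big1 => [|i ik].
    by rewrite addr0; apply: eq_bigr => j _; rewrite xE !mxE !eqxx mulr1.
  by rewrite big1// => j _; rewrite xE !mxE (negPf ik) andbF mulr0 mul0r.
Qed.
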